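(* Let $X$ be a discrete generalized ordered set and $Y$ any generalized ordered set. Then $X\times Y$ with the weak lexicographic order $<_w$ is a generalized ordered set.
   Context: The setting is constructive mathematics: no use of the law of excluded middle. For a set with a binary relation $<$, write $x\leq_{P}y$ if for all $z$, $z<x$ implies $z<y$, and $y<z$ implies $x<z$. A generalized ordered set is a set with a binary relation $<$ that is asymmetric ($x<y$ implies $\neg(y<x)$), transitive ($x<y<z$ implies $x<z$) and positively antisymmetric ($x\leq_{P}y$ and $y\leq_{P}x$ imply $x=y$). $X$ is discrete if for all $x,y\in X$, $x<y$ or $x=y$ or $y<x$. The product $X\times Y$ has componentwise equality. The weak lexicographic order is: $(x,y)<_w(x',y')$ iff (1) $x\leq_{P}x'$ in $X$; (2) $x=x'$ implies $y<y'$; and (3) $\neg(x=x')$ implies $x<x'$. *)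

(* Defs.v *)
(* A set is a Bishop set: a type with an equivalence relation as its equality,
   which relations on the set must respect.  Leibniz equality is the special
   case [eqA := eq]. *)
From Stdlib Require Import RelationClasses Morphisms.

Definition leP {A : Type} (ltA : A -> A -> Prop) (x y : A) : Prop :=
  forall z : A, (ltA z x -> ltA z y) /\ (ltA y z -> ltA x z).

Record generalized_ordered_set {A : Type} (eqA ltA : A -> A -> Prop) : Prop := {
  gos_eq_equiv : Equivalence eqA;
  gos_lt_ext : Proper (eqA ==> eqA ==> iff) ltA;
  gos_asym : forall x y : A, ltA x y -> ~ ltA y x;
  gos_trans : forall x y z : A, ltA x y -> ltA y z -> ltA x z;
  gos_pos_antisym : forall x y : A, leP ltA x y -> leP ltA y x -> eqA x y
}.

Definition discrete {A : Type} (eqA ltA : A -> A -> Prop) : Prop :=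
  forall x y : A, ltA x y \/ eqA x y \/ ltA y x.

Definition wlex {X Y : Type} (eqX ltX : X -> X -> Prop) (ltY : Y -> Y -> Prop)
    (p q : X * Y) : Prop :=
  leP ltX (fst p) (fst q) /\
  (eqX (fst p) (fst q) -> ltY (snd p) (snd q)) /\
  (~ eqX (fst p) (fst q) -> ltX (fst p) (fst q)).

(* Main.v *)
(* Over a discrete [X] the weak lexicographic order coincides with the usual
   one: [x < x'], or [x = x'] and [y < y'].  Positive antisymmetry then follows
   by trichotomy on the first components: comparability of [x] and [x'] would
   make a pair smaller than itself, and when [x = x'] the order on the fibre
   over [x] is that of [Y]. *)
Require Import Defs.
From Stdlib Require Import RelationPairs Setoid Morphisms.

Section WeakLexicographic.

Context {X Y : Type} {eqX ltX : X -> X -> Prop} {eqY ltY : Y -> Y -> Prop}.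
Hypothesis HX : generalized_ordered_set eqX ltX.
Hypothesis HY : generalized_ordered_set eqY ltY.

#[local] Instance eqX_equivalence : Equivalence eqX := gos_eq_equiv _ _ HX.
#[local] Instance eqY_equivalence : Equivalence eqY := gos_eq_equiv _ _ HY.
#[local] Instance ltX_proper : Proper (eqX ==> eqX ==> iff) ltX := gos_lt_ext _ _ HX.
#[local] Instance ltY_proper : Proper (eqY ==> eqY ==> iff) ltY := gos_lt_ext _ _ HY.

Lemma lt_irrefl (x : X) : ~ ltX x x.
Proof. intros H. exact (gos_asym _ _ HX x x H H). Qed.

Lemma lt_neq (x x' : X) : ltX x x' -> ~ eqX x x'.
Proof. intros H E. rewrite E in H. exact (lt_irrefl _ H). Qed.

Lemma lt_leP (x x' : X) : ltX x x' -> leP ltX x x'.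
Proof.
  intros H z; split; intros Hz.
  - exact (gos_trans _ _ HX _ _ _ Hz H).
  - exact (gos_trans _ _ HX _ _ _ H Hz).
Qed.

Lemma eq_leP (x x' : X) : eqX x x' -> leP ltX x x'.
Proof. intros E z; rewrite E; tauto. Qed.

(** Testing the upper half of [leP] at [x] itself would turn [x' < x] into [x < x]. *)
Lemma leP_not_gt (x x' : X) : leP ltX x x' -> ~ ltX x' x.
Proof. intros L H. exact (lt_irrefl _ (proj2 (L x) H)). Qed.

Hypothesis dX : discrete eqX ltX.

(** Trichotomy decides which of the two guarded clauses of [wlex] applies, and the [leP] clause
    rules out the third case. The disjunctive form is what later proofs split on. *)
Lemma wlex_iff_lex (p q : X * Y) :
  wlex eqX ltX ltY p q <->
  ltX (fst p) (fst q) \/ (eqX (fst p) (fst q) /\ ltY (snd p) (snd q)).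
Proof.
  split.
  - intros (L & E & _).
    destruct (dX (fst p) (fst q)) as [H | [H | H]].
    + now left.
    + right; auto.
    + destruct (leP_not_gt _ _ L H).
  - intros [H | [E H]]; (split; [| split]).
    + exact (lt_leP _ _ H).
    + intros E; destruct (lt_neq _ _ H E).
    + now intros _.
    + exact (eq_leP _ _ E).
    + now intros _.
    + intros N; destruct (N E).
Qed.

(** The lexicographic form is built from [ltX], [eqX] and [ltY] alone, all of which respect
    equality. *)
Lemma wlex_proper :
  Proper (RelProd eqX eqY ==> RelProd eqX eqY ==> iff) (wlex eqX ltX ltY).
Proof.
  intros p p' [E1 E2] q q' [F1 F2].
  unfold RelCompFun in *.
  now rewrite !wlex_iff_lex, E1, E2, F1, F2.
Qed.

Lemma wlex_asym (p q : X * Y) :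
  wlex eqX ltX ltY p q -> ~ wlex eqX ltX ltY q p.
Proof.
  rewrite !wlex_iff_lex.
  intros [H | [E H]] [K | [F K]].
  - exact (gos_asym _ _ HX _ _ H K).
  - exact (lt_neq _ _ H (symmetry F)).
  - exact (lt_neq _ _ K (symmetry E)).
  - exact (gos_asym _ _ HY _ _ H K).
Qed.

Lemma wlex_trans (p q r : X * Y) :
  wlex eqX ltX ltY p q -> wlex eqX ltX ltY q r -> wlex eqX ltX ltY p r.
Proof.
  rewrite !wlex_iff_lex.
  intros [H | [E H]] [K | [F K]].
  - left; exact (gos_trans _ _ HX _ _ _ H K).
  - left; now rewrite <- F.
  - left; now rewrite E.
  - right; split.
    + now rewrite E.
    + exact (gos_trans _ _ HY _ _ _ H K).
Qed.

Lemma leP_wlex_fst_not_gt (p q : X * Y) :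
  leP (wlex eqX ltX ltY) p q -> ~ ltX (fst q) (fst p).
Proof.
  intros L H.
  assert (K : wlex eqX ltX ltY q p) by (apply wlex_iff_lex; now left).
  (* The test element is [q]: being below [p], it must lie below [q]. *)
  pose proof (proj1 (L q) K) as Hqq.
  exact (wlex_asym _ _ Hqq Hqq).
Qed.

(** A test element [z] of [Y] is lifted to the fibre over the common first component. A comparison
    of the lifted pair with [p] or [q] must then come from [ltY], since [ltX] excludes equality. *)
Lemma leP_wlex_snd (p q : X * Y) :
  eqX (fst p) (fst q) -> leP (wlex eqX ltX ltY) p q -> leP ltY (snd p) (snd q).
Proof.
  intros E L z; split; intros Hz.
  - assert (K : wlex eqX ltX ltY (fst p, z) p)
      by (apply wlex_iff_lex; right; split; [reflexivity | exact Hz]).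
    apply (proj1 (L _)) in K.
    apply wlex_iff_lex in K as [K | [_ K]]; [| exact K].
    destruct (lt_neq _ _ K E).
  - assert (K : wlex eqX ltX ltY q (fst q, z))
      by (apply wlex_iff_lex; right; split; [reflexivity | exact Hz]).
    apply (proj2 (L _)) in K.
    apply wlex_iff_lex in K as [K | [_ K]]; [| exact K].
    destruct (lt_neq _ _ K E).
Qed.

Lemma wlex_pos_antisym (p q : X * Y) :
  leP (wlex eqX ltX ltY) p q -> leP (wlex eqX ltX ltY) q p ->
  RelProd eqX eqY p q.
Proof.
  intros Lpq Lqp.
  assert (E : eqX (fst p) (fst q)).
  { destruct (dX (fst p) (fst q)) as [H | [H | H]]; [| exact H |].
    - destruct (leP_wlex_fst_not_gt _ _ Lqp H).
    - destruct (leP_wlex_fst_not_gt _ _ Lpq H). }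
  split; [exact E |].
  apply (gos_pos_antisym _ _ HY); apply leP_wlex_snd; trivial.
  now symmetry.
Qed.

End WeakLexicographic.

(* [RelProd] is componentwise equality on pairs. *)
Theorem theorem27 (X Y : Type) (eqX ltX : X -> X -> Prop) (eqY ltY : Y -> Y -> Prop)
    (HX : generalized_ordered_set eqX ltX) (dX : discrete eqX ltX)
    (HY : generalized_ordered_set eqY ltY) :
  generalized_ordered_set (RelProd eqX eqY) (wlex eqX ltX ltY).
Proof.
  (* With both equivalences in context, instance search can derive the one for [RelProd]. *)
  pose proof (gos_eq_equiv _ _ HX).
  pose proof (gos_eq_equiv _ _ HY).
  split.
  - exact _.
  - exact (wlex_proper HX HY dX).
  - exact (wlex_asym HX HY dX).
  - exact (wlex_trans HX HY dX).
  - exact (wlex_pos_antisym HX HY dX).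
Qed.
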